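(* Let $s\ge1$ and $f\in\ell(\mathbb{Z}^s)$. Then $H(f)$ is a Hankel operator of finite rank if and only if there exist a finite set $\Omega\subset(\mathbb{R}+i\mathbb{T})^s$, finite dimensional $D$-invariant spaces $\mathcal{Q}_\theta\subset\Pi$ with bases $Q_\theta$, $\theta\in\Theta:=e^\Omega$, and a nonsingular block diagonal matrix $$F_{e^\Omega,Q_\Omega} = \operatorname{diag}\big(F_\omega\in\mathbb{C}^{\dim\mathcal{Q}_\theta\times\dim\mathcal{Q}_\theta},\ \theta=e^\omega : \omega\in\Omega\big)$$ such that $$H_{A,B}(f) = V(\Theta,Q_\Theta;A)^T\,F_{e^\Omega,Q_\Omega}\,V(\Theta,Q_\Theta;B),\qquad A,B\subseteq\mathbb{N}_0^s,$$ and, in particular, $$H(f) = V(\Theta,Q_\Theta;\mathbb{N}_0^s)^T\,F_{e^\Omega,Q_\Omega}\,V(\Theta,Q_\Theta;\mathbb{N}_0^s).$$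
   Context: $\mathbb{N}_0 = \{0,1,2,\dots\}$; $\ell(\mathbb{Z}^s)$ is the complex vector space of all functions (sequences) $f:\mathbb{Z}^s\to\mathbb{C}$; $\Pi=\mathbb{C}[z_1,\dots,z_s]$; $\mathbb{T}=\mathbb{R}/(2\pi\mathbb{Z})$. For $\omega\in(\mathbb{R}+i\mathbb{T})^s$ write $e^\omega=(e^{\omega_1},\dots,e^{\omega_s})\in(\mathbb{C}\setminus\{0\})^s$ and $e^\Omega=\{e^\omega:\omega\in\Omega\}$. For $A,B\subset\mathbb{Z}^s$ the Hankel matrix of $f$ is $H_{A,B}(f) = \big(f(\alpha+\beta)\big)_{\alpha\in A,\ \beta\in B}$. The operator $H(f)$ is of finite rank if $\operatorname{rank} H(f) := \sup\{\operatorname{rank} H_{A,B}(f) : A,B\subset\mathbb{Z}^s\text{ finite}\}<\infty$. In the last factorization $H(f)$ denotes the infinite matrix $\big(f(\alpha+\beta)\big)_{\alpha,\beta\in\mathbb{N}_0^s}$. For $p(z)=\sum_\alpha p_\alpha z^\alpha\in\Pi$, $p(D)=\sum_\alpha p_\alpha\,\partial^{|\alpha|}/\partial x^\alpha$ is the induced differential operator. A subspace $\mathcal{Q}\subseteq\Pi$ is $D$-invariant if $q\in\mathcal{Q}$ implies $p(D)q\in\mathcal{Q}$ for all $p\in\Pi$. For a finite set $\Theta\subset\mathbb{C}^s$, finite sets $Q_\theta\subset\Pi$, $\theta\in\Theta$, with $Q_\Theta=(Q_\theta:\theta\in\Theta)$, and $A\subseteq\mathbb{N}_0^s$, the Hermite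 Vandermonde matrix is $$V(\Theta,Q_\Theta;A)=\Big(\big(q(D)(\cdot)^\alpha\big)(\theta)\Big)_{(\theta,q):\,\theta\in\Theta,\ q\in Q_\theta;\ \alpha\in A},$$ with rows indexed by the pairs $(\theta,q)$ and columns by $\alpha$, where $(\cdot)^\alpha$ is the monomial $x\mapsto x^\alpha$. The rows and columns of the block $F_\omega$ are indexed by $Q_\theta$, $\theta=e^\omega$.
   Formalization: The converse as printed fails (f supported at (-1,…,-1) vanishes on N_0^s but has infinite rank), so the right-hand side also requires the factorization, with the same Ω, Q, F, for all A,B ⊆ Z^s, using q(D) on Laurent monomials at the points θ. *)

(* Defs.v *)
From HB Require Import structures.
From mathcomp Require Import all_boot all_order all_algebra.
From mathcomp Require Import generic_quotient finmap complex mpoly.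
From mathcomp Require Import boolp classical_sets reals sequences exp trigo.
Set Implicit Arguments.
Unset Strict Implicit.
Unset Printing Implicit Defensive.

Import Order.TTheory GRing.Theory Num.Theory.

Local Open Scope ring_scope.
Local Open Scope classical_set_scope.

Definition torus_rel (R : realType) (x y : R) : bool :=
  `[< exists k : int, x - y = k%:~R * (pi *+ 2) >].

Lemma torus_rel_refl (R : realType) : reflexive (@torus_rel R).
Proof. by move=> x; apply/asboolP; exists 0; rewrite subrr mul0r. Qed.

Lemma torus_rel_sym (R : realType) : ssrbool.symmetric (@torus_rel R).
Proof.
by move=> x y; apply/asboolP/asboolP => -[k e]; exists (- k);
  rewrite mulrNz mulNr -e opprB.
Qed.

Lemma torus_rel_trans (R : realType) : transitive (@torus_rel R).
Proof.
move=> y x z /asboolP[k e] /asboolP[l e']; apply/asboolP; exists (k + l).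
by rewrite mulrzDr mulrDl -e -e' addrA subrK.
Qed.

Canonical torus_equiv (R : realType) :=
  EquivRel (@torus_rel R) (@torus_rel_refl R) (@torus_rel_sym R)
    (@torus_rel_trans R).

Definition torus (R : realType) := {eq_quot (torus_equiv R)}%qT.

HB.instance Definition _ (R : realType) := Choice.on (torus R).
HB.instance Definition _ (R : realType) := EqQuotient.on (torus R).

(* exp (x + i t); it does not depend on the representative of t : torus R *)
Definition cyl_exp (R : realType) (w : R * torus R) : R[i] :=
  (expR w.1)%:C%C * (cos (repr w.2) +i* sin (repr w.2))%C.

Definition freq (R : realType) (s : nat) := {ffun 'I_s -> R * torus R}.

Definition freq_exp (R : realType) (s : nat) (w : freq R s) : 'I_s -> R[i] :=
  fun i => cyl_exp (w i).

Notation Zs s := {ffun 'I_s -> int}.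

Definition N0s (s : nat) : set (Zs s) := [set a | forall i, 0 <= a i].
Arguments N0s s : clear implicits.

(* the exponent in N^s of a multi-index; only meaningful on N0s *)
Definition mnm_of (s : nat) (a : Zs s) : 'X_{1..s} :=
  [multinom `|a i|%N | i < s].

(* H_{A,B}(f), for arbitrary index sets *)
Definition hankel (R : realType) (s : nat) (f : Zs s -> R[i])
    (A B : set (Zs s)) : A -> B -> R[i] :=
  fun a b => f (\val a + \val b).
Arguments hankel {R s} f A B.

(* H_{A,B}(f) as a matrix, for finite index sets *)
Definition hankel_mx (R : realType) (s : nat) (f : Zs s -> R[i])
    (A B : {fset Zs s}) : 'M[R[i]]_(#|` A|, #|` B|) :=
  \matrix_(i, j) f ((enum_fset A)`_i + (enum_fset B)`_j).

(* The supremum of the ranks of all finite H_{A,B}(f), a set of natural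
   numbers, is finite. *)
Definition hankel_finite_rank (R : realType) (s : nat) (f : Zs s -> R[i]) :
    Prop :=
  exists r : nat, forall A B : {fset Zs s}, (\rank (hankel_mx f A B) <= r)%N.

(* p(D) q *)
Definition polyD (C : comNzRingType) (s : nat) (p q : {mpoly C[s]}) :
    {mpoly C[s]} :=
  \sum_(m <- msupp p) p@_m *: q^`M[m].

Definition D_invariant (C : comNzRingType) (s : nat) (S : {pred {mpoly C[s]}}) :
    Prop :=
  forall q, q \in S -> forall p, polyD p q \in S.

Definition is_basis (C : nzRingType) (V : lmodType C) (n : nat)
    (b : n.-tuple V) (S : {pred V}) : Prop :=
  (forall c : 'I_n -> C,
     \sum_i c i *: tnth b i = 0 -> forall i, c i = 0) /\
  (forall v, v \in S <-> exists c : 'I_n -> C, v = \sum_i c i *: tnth b i).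

(* The rows of the Hermite Vandermonde matrices, and of the block diagonal
   matrix \mxdiag_i F i, are indexed by 'I_(\sum_i n i): the row r stands for
   the pair (theta i, j-th element of Q i) with i = tagnat.sig1 r and
   j = tagnat.sig2 r. *)
Definition hermite_vandermonde (C : comNzRingType) (s m : nat) (n : 'I_m -> nat)
    (theta : 'I_m -> 'I_s -> C) (Q : forall i, (n i).-tuple {mpoly C[s]})
    (A : set (Zs s)) : 'I_(\sum_i n i) -> A -> C :=
  fun r a => (polyD (tnth (Q (tagnat.sig1 r)) (tagnat.sig2 r))
                    'X_[mnm_of (\val a)]).@[theta (tagnat.sig1 r)].

(* a (a - 1) ... (a - k + 1) *)
Definition ffactz (a : int) (k : nat) : int := \prod_(j < k) (a - j%:Z).

(* q(D) applied to the Laurent monomial x^a and evaluated at a point x with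
   nonzero coordinates: d^k x_i^(a_i) = a_i (a_i - 1) ... (a_i - k + 1)
   x_i^(a_i - k) also holds for negative a_i. *)
Definition polyD_laurent (C : fieldType) (s : nat) (q : {mpoly C[s]})
    (a : Zs s) (x : 'I_s -> C) : C :=
  \sum_(m <- msupp q) q@_m *
    \prod_i ((ffactz (a i) (m i))%:~R * x i ^ (a i - (m i)%:Z)).

Lemma ffactzE (n k : nat) : ffactz n k = (n ^_ k)%:Z.
Proof.
rewrite /ffactz; elim: k => [|k IH]; first by rewrite big_ord0.
rewrite big_ord_recr /= IH ffactnSr PoszM.
case: (leqP k n) => [le_kn|lt_nk]; first by rewrite -subzn.
by rewrite ffact_small // !mul0r.
Qed.

Lemma polyD_laurentE (C : fieldType) (s : nat) (q : {mpoly C[s]}) (a : Zs s)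
    (x : 'I_s -> C) :
  N0s s a -> polyD_laurent q a x = (polyD q 'X_[mnm_of a]).@[x].
Proof.
move=> a_ge0; rewrite /polyD raddf_sum; apply: eq_bigr => m _ /=.
rewrite mderivmX !mevalZ mevalX natr_prod -big_split; congr (_ * _).
apply: eq_bigr => i _; rewrite mnmBE mnmE.
have := a_ge0 i; case: (a i) => // k _; rewrite ffactzE /=.
case: (leqP (m i) k) => [le_mk|lt_km]; first by rewrite subzn.
by rewrite ffact_small // !mul0r.
Qed.

(* The Hermite Vandermonde matrix of points with nonzero coordinates, with
   columns indexed by multi-indices in Z^s; it agrees with hermite_vandermonde
   on N_0^s by polyD_laurentE. A factorization of H_{A,B}(f) for A and B in
   N_0^s says nothing about f outside N_0^s (take f supported at (-1,..,-1)),
   so it cannot imply that H(f) has finite rank over Z^s; the factorization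
   with these matrices for A and B in Z^s does. *)
Definition laurent_vandermonde (C : fieldType) (s m : nat) (n : 'I_m -> nat)
    (theta : 'I_m -> 'I_s -> C) (Q : forall i, (n i).-tuple {mpoly C[s]})
    (A : set (Zs s)) : 'I_(\sum_i n i) -> A -> C :=
  fun r a => polyD_laurent (tnth (Q (tagnat.sig1 r)) (tagnat.sig2 r))
               (\val a) (theta (tagnat.sig1 r)).

(* V^T F W, for V and W with N rows and possibly infinitely many columns *)
Definition trmul3 (C : nzRingType) (N : nat) (X Y : Type)
    (V : 'I_N -> X -> C) (F : 'M[C]_N) (W : 'I_N -> Y -> C) : X -> Y -> C :=
  fun x y => \sum_k \sum_l V k x * F k l * W l y.

(* Main.v *)
Require Import Defs.
From mathcomp Require Import all_boot all_order all_algebra.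
From mathcomp Require Import generic_quotient finmap complex mpoly.
From mathcomp Require Import boolp classical_sets reals sequences exp trigo.

Set Implicit Arguments.
Unset Strict Implicit.
Unset Printing Implicit Defensive.

Import Order.TTheory GRing.Theory Num.Theory.

Local Open Scope ring_scope.
Local Open Scope classical_set_scope.

(** The converse is a rank count: a factorization of H(f) through a space of
    dimension N bounds the rank of every finite Hankel matrix by N.

    For the direct implication, take a nonsingular Hankel matrix of largest
    size n. By maximality every bordered matrix is singular, and the vanishing
    of its Schur complement is a factorization
      f(x + y) = u(x) G u(y)^T
    with u : Z^s -> K^n and G nonsingular ([symmetric_realization]). The
    commutativity of Z^s then gives commuting invertible matrices T_z with
    u(x + z) = u(x) T_z and T_z G = G T_z^T: f is a matrix coefficient of a
    representation of Z^s on K^n, self-adjoint for the form G.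

    The commuting matrices have joint spectral idempotents
    ([joint_spectral_idempotents]): K^n is the direct sum of the images of
    idempotents E_theta which are polynomials in the T_z and on which T_(e_i)
    is theta_i plus a nilpotent h_i. Since the T_z are invertible, theta has
    nonzero coordinates as soon as E_theta is nonzero, hence theta = e^omega.

    Expanding the binomials (theta_i + h_i)^(a_i) shows that the function
    a |-> u(0) T_a E_theta w is a |-> (q_w(D) x^a)(theta) for the polynomial
      q_w = sum_m (u(0) h^m E_theta w / m!) x^m.
    Instead of this expansion, the proof compares how both sides change under
    translations: Leibniz' rule says that q(D) applied to x_i x^a is
    (x_i q(D) + (d_i q)(D)) x^a, and d_i q_w = q_(h_i w), so that translating
    by e_i acts on both sides as w |-> (theta_i + h_i) w = T_(e_i) w
    ([matcoef_polyP]). This also covers negative exponents, and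
    d_i q_w = q_(h_i w) is the D-invariance of the space of all q_w, which is
    isomorphic to the image of E_theta.

    Finally f(x + y) is the sum over theta of u(x) E_theta G u(y)^T, and
    E_theta G = E_theta G E_theta^T. With a rank factorization
    E_theta = C R one has R C = 1, the rows u(x) C are those of the
    Vandermonde matrix for the basis given by the columns of C, and
    F = R G R^T is the block of theta; it is inverted by C^T G^-1 C. *)

(** * Points with nonzero coordinates are exponentials *)

Lemma torus_repr (R : realType) (t : R) :
  exists k : int, repr (\pi_(torus R)%qT t) = t + k%:~R * (pi *+ 2).
Proof.
have /eqmodP/asboolP[k e] : (repr (\pi_(torus R)%qT t) = t %[mod torus R])%qT.
  by rewrite reprK.
by exists k; rewrite -e addrC subrK.
Qed.

Lemma periodic_int (U V : zmodType) (f : U -> V) (a : U) (k : int) x :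
  periodic f a -> f (x + a *~ k) = f x.
Proof.
move=> fa; case: k => n; first by rewrite -pmulrn periodicn.
by rewrite NegzE mulrNz -pmulrn -[in RHS](subrK (a *+ n.+1) x) periodicn.
Qed.

Lemma cyl_exp_pi (R : realType) (x t : R) :
  cyl_exp (x, \pi_(torus R)%qT t) = ((expR x)%:C * (cos t +i* sin t))%C.
Proof.
rewrite /cyl_exp /=; have [k ->] := torus_repr t.
have -> : k%:~R * (pi *+ 2) = (pi *+ 2) *~ k :> R by rewrite mulrzl.
by rewrite (periodic_int _ _ (@cosD2pi R)) (periodic_int _ _ (@sinD2pi R)).
Qed.

Lemma polar_angle (R : realType) (a b : R) :
  a ^+ 2 + b ^+ 2 = 1 -> exists t, cos t = a /\ sin t = b.
Proof.
move=> ab1; have a1 : -1 <= a <= 1.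
  by rewrite -ler_norml -sqrtr_sqr -[1]sqrtr1 ler_wsqrtr // -ab1 lerDl sqr_ge0.
have sa : sin (acos a) = `|b|.
  by rewrite sin_acos // -ab1 addrAC subrr add0r sqrtr_sqr.
case: (leP 0 b) => b0; [exists (acos a)|exists (- acos a)].
  by rewrite acosK ?in_itv //= sa ger0_norm.
by rewrite cosN sinN acosK ?in_itv //= sa ltr0_norm // opprK.
Qed.

Lemma cyl_exp_surj (R : realType) (z : R[i]) :
  z != 0 -> exists w : R * torus R, cyl_exp w = z.
Proof.
case: z => a b z0; pose r := Num.sqrt (a ^+ 2 + b ^+ 2).
have r0 : 0 < r.
  rewrite sqrtr_gt0 lt0r addr_ge0 ?sqr_ge0 // andbT paddr_eq0 ?sqr_ge0 //.
  by rewrite !sqrf_eq0; apply: contra z0 => /andP[/eqP-> /eqP->].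
have [t [ct st]] : exists t, cos t = a / r /\ sin t = b / r.
  apply: polar_angle; rewrite !expr_div_n -mulrDl sqr_sqrtr ?divff //.
    by rewrite -[X in X != _]sqr_sqrtr ?sqrf_eq0 ?gt_eqF // addr_ge0 ?sqr_ge0.
  by rewrite addr_ge0 ?sqr_ge0.
exists (ln r, \pi_(torus R)%qT t); rewrite cyl_exp_pi lnK ?posrE // ct st.
apply/eqP; rewrite eq_complex /= !mul0r subr0 addr0.
by rewrite ![r * _]mulrC !divfK ?(gt_eqF r0) ?eqxx.
Qed.

Lemma freq_exp_surj (R : realType) (s : nat) (z : 'I_s -> R[i]) :
  (forall i, z i != 0) -> exists w : freq R s, freq_exp w = z.
Proof.
move=> z0; have /(_ _)/cid w_ i := cyl_exp_surj (z0 i).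
exists [ffun i => projT1 (w_ i)]; apply: funext => i.
by rewrite /freq_exp ffunE; case: (w_ i).
Qed.

(** * Symmetric realization of a finite rank Hankel operator *)

(** The points may repeat, unlike the index sets of [hankel_mx]; repeated points
    only make the matrix singular. *)
Definition hankel_minor (K : Type) (s : nat) (f : Zs s -> K) (n p : nat)
    (a : 'I_n -> Zs s) (b : 'I_p -> Zs s) : 'M[K]_(n, p) :=
  \matrix_(i, j) f (a i + b j).

Lemma mxrank_mxsub (K : fieldType) (m n p q : nat) (A : 'M[K]_(m, n))
    (g : 'I_p -> 'I_m) (h : 'I_q -> 'I_n) : (\rank (mxsub g h A) <= \rank A)%N.
Proof.
rewrite mxsubrc (leq_trans (mxrankS (rowsub_sub _ _))) //.
by rewrite -mxrank_tr trmx_mxsub -[in leqRHS]mxrank_tr mxrankS ?rowsub_sub.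
Qed.

Lemma hankel_finite_rank_minor (R : realType) (s : nat) (f : Zs s -> R[i]) :
  hankel_finite_rank f -> exists r, forall n (a b : 'I_n -> Zs s),
    hankel_minor f a b \in unitmx -> (n <= r)%N.
Proof.
case=> r rk; exists r => n a b unitM.
pose S (c : 'I_n -> Zs s) : {fset Zs s} := seq_fset tt (codom c).
have lt_idx c i : (index (c i) (enum_fset (S c)) < #|` S c|)%N.
  by rewrite index_mem -[_ \in _]/(c i \in S c) seq_fsetE codom_f.
pose g c i := Ordinal (lt_idx c i).
have gE c i : (enum_fset (S c))`_(g c i) = c i.
  by rewrite nth_index // -index_mem lt_idx.
rewrite -(mxrank_unit unitM); apply: leq_trans (rk (S a) (S b)).
have -> : hankel_minor f a b = mxsub (g a) (g b) (hankel_mx f (S a) (S b)).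
  by apply/matrixP => i j; rewrite !mxE !gE.
exact: mxrank_mxsub.
Qed.

(** The scalar [a - b M^-1 c] is the Schur complement of [M]. *)
Lemma bordered_unitmx (K : fieldType) (n : nat) (a : 'M[K]_1) (b : 'rV[K]_n)
    (c : 'cV[K]_n) (M : 'M[K]_n) :
  M \in unitmx -> a - b *m invmx M *m c != 0 ->
  block_mx a b c M \in unitmx.
Proof.
move=> uM nz.
have -> : block_mx a b c M =
    block_mx (a - b *m invmx M *m c) (b *m invmx M) 0 1%:M *m
    block_mx 1%:M 0 c M.
  rewrite mulmx_block !mulmx1 !mulmx0 ?mul0mx !mul1mx !add0r subrK.
  by rewrite mulmxKV.
rewrite unitmx_mul !unitmxE det_ublock det_lblock !det1 mulr1 mul1r.
move: uM; rewrite unitmxE => ->; rewrite andbT unitfE det_mx11.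
apply: contra nz => /eqP e; apply/eqP/matrixP => i j.
by rewrite !ord1 e mxE.
Qed.

(** If the minor on the rows [a] and the columns [b] is nonsingular of maximal
    size, then f(x + y) = r_x M^-1 c_y, where r_x and c_y border [M]. Setting
    u(x) = r_x M^-1 makes u(a_i) a unit vector, and exchanging the roles of x
    and y expresses c_y by u(y), which makes the factorization symmetric. *)
Lemma symmetric_realization (K : fieldType) (s r : nat) (f : Zs s -> K) :
  (forall n (a b : 'I_n -> Zs s),
     hankel_minor f a b \in unitmx -> (n <= r)%N) ->
  exists (n : nat) (u : Zs s -> 'rV[K]_n) (a : 'I_n -> Zs s) (G : 'M[K]_n),
  [/\ forall i, u (a i) = delta_mx 0 i, G \in unitmx &
      forall x y, f (x + y) = (u x *m G *m (u y)^T) 0 0].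
Proof.
move=> le_r.
pose P n := `[< exists a b : 'I_n -> Zs s, hankel_minor f a b \in unitmx >].
have exP : exists n, P n.
  exists 0%N; apply/asboolP; exists (fun=> 0), (fun=> 0).
  by rewrite unitmxE det_mx00 unitr1.
have leP n : P n -> (n <= r)%N by move=> /asboolP[a [b]]; apply: le_r.
case: (ex_maxnP exP leP) => n /asboolP[a [b uM]] max_n {exP leP}.
set M := hankel_minor f a b in uM.
pose rw x : 'rV[K]_n := \row_j f (x + b j).
pose v y : 'cV[K]_n := \col_i f (a i + y).
pose u x := rw x *m invmx M.
have fE x y : f (x + y) = (u x *m v y) 0 0.
  apply/eqP; rewrite -subr_eq0; apply/negPn/negP => nz.
  have : P n.+1; last by move/max_n; rewrite ltnn.
  apply/asboolP.
  pose cons (z : Zs s) (c : 'I_n -> Zs s) (i : 'I_n.+1) :=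
    if unlift ord0 i is Some j then c j else z.
  exists (cons x a), (cons y b).
  have -> : hankel_minor f (cons x a) (cons y b) =
      block_mx (f (x + y))%:M (rw x) (v y) M :> 'M_(1 + n).
    apply/matrixP => i j; rewrite !mxE.
    case: splitP => i' ei; rewrite !mxE; case: splitP => j' ej; rewrite !mxE.
    - have -> : i = ord0 by apply: val_inj; rewrite /= ei ord1.
      have -> : j = ord0 by apply: val_inj; rewrite /= ej ord1.
      by rewrite /cons !unlift_none !ord1.
    - have -> : i = ord0 by apply: val_inj; rewrite /= ei ord1.
      have -> : j = lift ord0 j' by apply: val_inj; rewrite /= ej.
      by rewrite /cons unlift_none liftK.
    - have -> : i = lift ord0 i' by apply: val_inj; rewrite /= ei.
      have -> : j = ord0 by apply: val_inj; rewrite /= ej ord1.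
      by rewrite /cons unlift_none liftK.
    have -> : i = lift ord0 i' by apply: val_inj; rewrite /= ei.
    have -> : j = lift ord0 j' by apply: val_inj; rewrite /= ej.
    by rewrite /cons !liftK.
  apply: bordered_unitmx uM _; apply: contra nz => /eqP/matrixP/(_ 0 0).
  by rewrite !mxE -/(u x) => ->.
(* v_i(y) = f(y + a_i) = u(y) v(a_i), so G has the columns v(a_i). *)
pose G := hankel_minor f a a.
have ua i : u (a i) = delta_mx 0 i.
  have -> : u (a i) = row i M *m invmx M.
    by congr (_ *m _); apply/rowP => j; rewrite !mxE.
  by rewrite -row_mul mulmxV // row1.
have vE y : v y = G *m (u y)^T.
  apply/colP => i; rewrite mxE addrC fE !mxE; apply: eq_bigr => j _.
  by rewrite !mxE mulrC addrC.
exists n, u, a, G; split=> //.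
- have : G *m (\matrix_j u (b j))^T = M.
    apply/matrixP => i j; have /colP/(_ i) := vE (b j); rewrite !mxE => ->.
    by apply: eq_bigr => k _; rewrite !mxE.
  by move=> GM; move: uM; rewrite -GM unitmx_mul => /andP[].
by move=> x y; rewrite fE vE mulmxA.
Qed.

Section Translation.
Variables (K : fieldType) (s n : nat) (f : Zs s -> K).
Variables (u : Zs s -> 'rV[K]_n) (a : 'I_n -> Zs s) (G : 'M[K]_n).
Hypothesis ua : forall i, u (a i) = delta_mx 0 i.
Hypothesis unitG : G \in unitmx.
Hypothesis fE : forall x y, f (x + y) = (u x *m G *m (u y)^T) 0 0.

Definition translation (z : Zs s) : 'M[K]_n := \matrix_i u (a i + z).

(** The unit vectors are among the [u x]. *)
Lemma rows_separate p (A B : 'M[K]_(n, p)) :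
  (forall x, u x *m A = u x *m B) -> A = B.
Proof. by move=> AB; apply/row_matrixP => i; rewrite !rowE -ua. Qed.

Lemma mulG_translate y z : G *m (u (z + y))^T = translation z *m (G *m (u y)^T).
Proof.
apply/colP => i; have -> : (G *m (u (z + y))^T) i 0 = f (a i + z + y).
  by rewrite -addrA fE ua -mulmxA -rowE [RHS]mxE.
rewrite fE -[u (a i + z)](rowK (fun i => u (a i + z))) -/(translation z).
by rewrite -mulmxA -row_mul [LHS]mxE.
Qed.

(** Both sides agree when paired with any G u(y)^T, namely to f(x + z + y). *)
Lemma translationP x z : u (x + z) = u x *m translation z.
Proof.
apply: (can_inj (mulmxK unitG)); apply: trmx_inj; apply: rows_separate => y.
apply: trmx_inj; rewrite !trmx_mul !trmxK.
apply/matrixP => i j; rewrite !ord1 -fE -addrA fE -!mulmxA mulG_translate.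
by rewrite !mulmxA.
Qed.

Lemma translation0 : translation 0 = 1%:M.
Proof. by apply: rows_separate => x; rewrite -translationP addr0 mulmx1. Qed.

Lemma translationD y z : translation (y + z) = translation y *m translation z.
Proof.
by apply: rows_separate => x; rewrite mulmxA -!translationP addrA.
Qed.

(** f(x + z + y) does not depend on whether z is added to x or to y. *)
Lemma translation_selfadjoint z : translation z *m G = G *m (translation z)^T.
Proof.
apply: trmx_inj; apply: rows_separate => y; apply: trmx_inj.
rewrite !trmx_mul !trmxK -!mulmxA -mulG_translate [z + y]addrC translationP.
by rewrite trmx_mul.
Qed.

End Translation.

(** * Joint spectral idempotents of commuting matrices *)

Lemma dvdp_prod_coprime (K : fieldType) (I : eqType) (r : seq I)
    (F : I -> {poly K}) (p : {poly K}) :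
  uniq r -> {in r &, forall i j, i != j -> coprimep (F i) (F j)} ->
  {in r, forall i, F i %| p} -> \prod_(i <- r) F i %| p.
Proof.
elim: r => [|i r IH] /=; first by rewrite big_nil dvd1p.
move=> /andP[ir ur] co dv; rewrite big_cons Gauss_dvdp.
  rewrite dv ?mem_head //=; apply: IH => // [j k jr kr|j jr].
    by apply: co; rewrite inE ?jr ?kr orbT.
  by apply: dv; rewrite inE jr orbT.
rewrite big_seq; apply: (big_ind (fun p => coprimep (F i) p)) => [|p1 p2|].
    exact: coprimep1.
  by rewrite coprimepMr => -> ->.
move=> j jr; apply: co; rewrite ?mem_head ?inE ?jr ?orbT //.
by apply: contraNneq ir => ->.
Qed.

(** Chinese remaindering: [e j] is 1 modulo the [j]-th power and 0 modulo the
    others, hence an idempotent modulo [P] killed by the [j]-th power. *)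
Lemma poly_crt_idempotents (K : fieldType) (n N : nat) (a : 'I_n -> K) :
  injective a ->
  let P := \prod_j ('X - (a j)%:P) ^+ N in
  exists e : 'I_n -> {poly K},
  [/\ P %| \sum_j e j - 1,
      forall j, P %| ('X - (a j)%:P) ^+ N * e j &
      forall j, P %| e j * e j - e j].
Proof.
move=> inja P; pose F j := ('X - (a j)%:P) ^+ N.
have co i j : i != j -> coprimep (F i) (F j).
  move=> ij; rewrite coprimep_expl // coprimep_expr // coprimep_XsubC.
  rewrite root_XsubC.
  by apply: contra ij => /eqP/inja ->.
pose G j := \prod_(i | i != j) F i.
have PE j : P = F j * G j by rewrite /P (bigD1 j).
have coG j : coprimep (F j) (G j).
  rewrite /G; apply: (big_ind (fun p => coprimep (F j) p)) => [|p1 p2|].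
  - exact: coprimep1.
  - by rewrite coprimepMr => -> ->.
  - by move=> i ij; apply: co; rewrite eq_sym.
have /(_ _)/cid/= B j := Bezout_eq1_coprimepP _ _ (coG j).
pose e j := (projT1 (B j)).2 * G j; exists e.
have eB j : e j - 1 = - ((projT1 (B j)).1 * F j).
  by rewrite /e; case: (B j) => uv /= <-; rewrite opprD addrC addrNK.
split=> [|j|j].
- apply: (dvdp_prod_coprime (F := F)) => [|i j _ _|i _].
  + exact: index_enum_uniq.
  + exact: co.
  rewrite (bigD1 i) //= addrAC eB dvdp_add // ?dvdpNr ?dvdp_mull //.
  apply: (big_ind (fun q => F i %| q)) => [|p q|j ji].
  + exact: dvdp0.
  + exact: dvdp_add.
  by rewrite /e dvdp_mull // /G (bigD1 i) ?[i == j]eq_sym //= dvdp_mulr.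
- by rewrite (PE j) dvdp_mul // /e dvdp_mull.
rewrite -[X in _ - X]mulr1 -mulrBr eB mulrN dvdpNr (PE j) mulrC dvdp_mul //.
  by rewrite dvdp_mull.
by rewrite dvdp_mull.
Qed.

(** One polynomial for all the [T i], so that a single family of idempotents
    serves every coordinate. *)
Lemma common_annihilator (K : closedFieldType) (s n : nat)
    (T : 'I_s -> 'M[K]_n.+1) :
  exists (k N : nat) (a : 'I_k -> K), injective a /\
  forall i p, \prod_j ('X - (a j)%:P) ^+ N %| p -> horner_mx (T i) p = 0.
Proof.
(* The a_j are the distinct eigenvalues of the T_i, and N is at least every
   multiplicity. *)
pose P := \prod_i char_poly (T i).
have Pmon : P \is monic by apply: monic_prod => i _; apply: char_poly_monic.
have [rs rsP] := closed_field_poly_normal P.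
move: rsP; rewrite (monicP Pmon) scale1r => rsP.
pose S := undup rs; exists (size S), (size rs), (fun j => tnth (in_tuple S) j).
split.
  move=> i j; rewrite !(tnth_nth 0) /= => /eqP.
  by rewrite nth_uniq ?undup_uniq // => /eqP/val_inj.
move=> i p dv.
suff /dvdpP[q ->] : char_poly (T i) %| p.
  by rewrite rmorphM /= Cayley_Hamilton mulr0.
apply: dvdp_trans (_ : P %| _); first by rewrite /P (bigD1 i) //= dvdp_mulr.
apply: dvdp_trans dv; rewrite rsP -prodr_undup_exp_count.
rewrite -(big_tnth _ _ S xpredT (fun x => ('X - x%:P) ^+ size rs)).
apply: (big_ind2 (fun p q : {poly K} => p %| q)) => // [p1 q1 p2 q2|x _].
  exact: dvdp_mul.
by rewrite dvdp_exp2l // count_size.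
Qed.

Lemma horner_mx_closed (K : fieldType) (n : nat) (A : 'M[K]_n.+1)
    (P : 'M[K]_n.+1 -> Prop) (p : {poly K}) :
  (forall c, P c%:M) -> (forall B C, P B -> P C -> P (B + C)) ->
  (forall B C, P B -> P C -> P (B * C)) -> P A -> P (horner_mx A p).
Proof.
move=> PC PD PM PA; elim/poly_ind: p => [|p c IH].
  by rewrite rmorph0; have := PC 0; rewrite raddf0.
by rewrite rmorphD rmorphM /= horner_mx_X horner_mx_C; apply/PD/PC/PM.
Qed.

(** The product over [i] of the idempotents of [T i] for the eigenvalues [t i]
    projects onto the joint generalized eigenspace of the tuple. Some of these
    products may vanish. The last clause says that the idempotents are
    polynomials in the [T i]; it is stated as an induction principle because all
    that is needed of them is inherited through sums and products. *)
Lemma joint_spectral_idempotents (K : closedFieldType) (s n : nat)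
    (T : 'I_s -> 'M[K]_n.+1) :
  (forall i j, GRing.comm (T i) (T j)) ->
  exists (I : finType) (th : I -> 'I_s -> K) (E : I -> 'M[K]_n.+1) (N : nat),
  [/\ injective th, \sum_t E t = 1, forall t, E t * E t = E t,
      forall t i, (T i - (th t i)%:M) ^+ N * E t = 0 &
      forall t (P : 'M[K]_n.+1 -> Prop), (forall c, P c%:M) ->
        (forall A B, P A -> P B -> P (A + B)) ->
        (forall A B, P A -> P B -> P (A * B)) -> (forall i, P (T i)) ->
        P (E t)].
Proof.
move=> commT; have [k [N [a [inja ann]]]] := common_annihilator T.
have [e [e_sum e_nil e_id]] := poly_crt_idempotents N inja.
pose H i p := horner_mx (T i) p.
have commH i j p q : GRing.comm (H i p) (H j q).
  by apply/comm_mx_horner/comm_mx_sym/comm_mx_horner; apply: commT.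
pose E (t : {ffun 'I_s -> 'I_k}) := \prod_i H i (e (t i)).
exists {ffun 'I_s -> 'I_k}, (fun (t : {ffun _ -> _}) i => a (t i)), E, N; split.
- by move=> t t' tt'; apply/ffunP => i; apply: inja; move/(congr1 (@^~ i)): tt'.
- rewrite /E -(bigA_distr_bigA (fun i j => H i (e j))) big1 // => i _.
  have := ann i _ e_sum.
  by rewrite rmorphB rmorph1 rmorph_sum => /subr0_eq.
- move=> t; rewrite /E -prodrM_comm; last by move=> i j _ _; apply: commH.
  apply: eq_bigr => i _; have := ann i _ (e_id (t i)).
  by rewrite rmorphB rmorphM => /subr0_eq.
- move=> t i.
  have -> : (T i - (a (t i))%:M) ^+ N = H i (('X - (a (t i))%:P) ^+ N).
    by rewrite /H rmorphXn rmorphB /= horner_mx_X horner_mx_C.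
  have : H i (('X - (a (t i))%:P) ^+ N) * H i (e (t i)) = 0.
    by rewrite -rmorphM; apply: ann.
  rewrite /E; have : i \in index_enum _ by rewrite mem_index_enum.
  elim: (index_enum _) => //= j r IH; rewrite inE big_cons.
  have [<- _ He|_ /= ir He] := eqVneq i j; first by rewrite mulrA He mul0r.
  by rewrite mulrA commH -mulrA IH ?mulr0.
move=> t P PC PD PM PT; rewrite /E.
apply: (big_ind P) => [|//|i _]; first exact: (PC 1).
exact: horner_mx_closed.
Qed.

(** * Matrix coefficients as values of differential operators *)

Definition unitZ (s : nat) (i : 'I_s) : Zs s := [ffun j => (j == i)%:Z].

Lemma ffactzS (a : int) (k : nat) : ffactz a k.+1 = ffactz a k * (a - k%:Z).
Proof. by rewrite /ffactz big_ord_recr. Qed.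

Lemma ffactzSl (a : int) (k : nat) : ffactz (a + 1) k.+1 = (a + 1) * ffactz a k.
Proof.
rewrite /ffactz big_ord_recl subr0; congr (_ * _); apply: eq_bigr => j _.
by rewrite /bump /= PoszD opprD addrA addrK.
Qed.

(** The Leibniz rule for the [k]-th derivative of x * x^a, on coefficients. *)
Lemma ffactz_pascal (a : int) (k : nat) :
  ffactz (a + 1) k = ffactz a k + k%:Z * ffactz a k.-1.
Proof.
case: k => [|k]; first by rewrite /ffactz !big_ord0 mul0r addr0.
rewrite ffactzSl ffactzS /= [k.+1%:Z * _]mulrC -mulrDr [LHS]mulrC.
by rewrite -addn1 PoszD addrA subrK.
Qed.

Section LaurentEval.
Variables (K : fieldType) (s : nat).
Implicit Types (q : {mpoly K[s]}) (a : Zs s) (x : 'I_s -> K).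

Lemma polyD_laurentwE k q a x : (msize q <= k)%N ->
  polyD_laurent q a x = \sum_(m : 'X_{1..s < k}) q@_m *
    \prod_i ((ffactz (a i) (m i))%:~R * x i ^ (a i - (m i)%:Z)).
Proof.
move=> le_qk; pose I : subFinType _ := 'X_{1..s < k}.
rewrite /polyD_laurent (ssrcomplements.big_mksub I) ?msupp_uniq //=.
  by rewrite big_rmcond //= => j /memN_msupp_eq0 ->; rewrite mul0r.
by move=> m /msize_mdeg_lt /leq_trans; apply.
Qed.

Lemma polyD_laurentX (m : 'X_{1..s}) a x : polyD_laurent 'X_[m] a x =
  \prod_i ((ffactz (a i) (m i))%:~R * x i ^ (a i - (m i)%:Z)).
Proof. by rewrite /polyD_laurent msuppX big_seq1 mcoeffX eqxx mul1r. Qed.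

Lemma polyD_laurent_linear c p q a x :
  polyD_laurent (c *: p + q) a x =
  c * polyD_laurent p a x + polyD_laurent q a x.
Proof.
pose k := maxn (maxn (msize p) (msize q)) (msize (c *: p + q)).
rewrite !(@polyD_laurentwE k) ?leq_max ?leqnn ?orbT //.
rewrite mulr_sumr -big_split /=; apply: eq_bigr => m _.
by rewrite mcoeffD mcoeffZ mulrDl mulrA.
Qed.

Lemma polyD_laurent0 a x : polyD_laurent (0 : {mpoly K[s]}) a x = 0.
Proof. by rewrite /polyD_laurent msupp0 big_nil. Qed.

Lemma polyD_laurentZ c q a x :
  polyD_laurent (c *: q) a x = c * polyD_laurent q a x.
Proof. by rewrite -[c *: q]addr0 polyD_laurent_linear polyD_laurent0 addr0. Qed.

Lemma polyD_laurent_at0 q x : polyD_laurent q 0 x = q@_0.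
Proof.
elim/mpolyind: q => [|c m q _ _ IH]; first by rewrite polyD_laurent0 mcoeff0.
rewrite polyD_laurent_linear IH polyD_laurentX mcoeffD mcoeffZ mcoeffX.
congr (c * _ + _); have [->|/eqP m0] := eqVneq m 0%MM.
  by rewrite big1 // => i _; rewrite mnm0E ffunE /ffactz big_ord0 subr0 mulr1.
have [i mi] : exists i, m i != 0%N.
  apply/existsP; rewrite -negb_forall; apply/negP => /forallP m_0.
  apply: m0; apply/mnmP => i; rewrite mnm0E; apply/eqP.
  by rewrite -[_ == _]negbK m_0.
rewrite (bigD1 i) //= ffunE; case: (m i) mi => // k _.
by rewrite /ffactz big_ord_recl subrr mul0r !mul0r.
Qed.

(** Multiplication by a coordinate is dual to differentiation of the symbol:
    q(D) (x_i g) = x_i q(D) g + (d_i q)(D) g, applied to g = x^a. *)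
Lemma polyD_laurent_shift q a x i : x i != 0 ->
  polyD_laurent q (a + unitZ i) x = polyD_laurent (x i *: q + q^`M(i)) a x.
Proof.
move=> xi0; elim/mpolyind: q => [|c m q _ _ IH].
  by rewrite mderiv0 scaler0 addr0 !polyD_laurent0.
have -> : x i *: (c *: 'X_[m] + q) + (c *: 'X_[m] + q)^`M(i) =
    c *: (x i *: 'X_[m] + 'X_[m]^`M(i)) + (x i *: q + q^`M(i)).
  by rewrite mderivD mderivZ !scalerDr addrACA !scalerA mulrC.
rewrite 2!(polyD_laurent_linear c) IH; congr (c * _ + _).
rewrite mderivX polyD_laurent_linear polyD_laurentZ !polyD_laurentX.
(* Only the i-th factors of the three products differ. *)
rewrite (bigD1 i) //= [X in x i * X](bigD1 i) //=.
rewrite [X in (m i)%:R * X](bigD1 i) //=.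
have e1 : \prod_(j < s | j != i)
    ((ffactz ((a + unitZ i) j) (m j))%:~R *
     x j ^ ((a + unitZ i) j - (m j)%:Z)) =
    \prod_(j < s | j != i) ((ffactz (a j) (m j))%:~R * x j ^ (a j - (m j)%:Z)).
  by apply: eq_bigr => j ji; rewrite !ffunE (negbTE ji) addr0.
have e2 : \prod_(j < s | j != i)
    ((ffactz (a j) ((m - U_(i))%MM j))%:~R *
     x j ^ (a j - ((m - U_(i))%MM j)%:Z)) =
    \prod_(j < s | j != i) ((ffactz (a j) (m j))%:~R * x j ^ (a j - (m j)%:Z)).
  by apply: eq_bigr => j ji; rewrite mnmBE mnm1E eq_sym (negbTE ji) subn0.
rewrite e1 e2 !mulrA -mulrDl !ffunE mnmBE mnm1E eqxx subn1 ffactz_pascal.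
congr (_ * _); rewrite rmorphD rmorphM mulrDl /=; congr (_ + _).
  rewrite [x i * _]mulrC -mulrA [X in x i ^ X]addrAC (expfzDr _ 1) //.
  by congr (_ * _); rewrite mulrC.
case: (m i) => [|k] /=; first by rewrite !mul0r.
have -> // : a i + 1 - k.+1%:Z = a i - k%:Z.
by rewrite -addn1 PoszD opprD addrA addrAC addrK.
Qed.

End LaurentEval.

Lemma mmap1_comm_add (A : nzRingType) (s : nat) (h : 'I_s -> A)
    (m m' : 'X_{1..s}) :
  (forall i j, GRing.comm (h i) (h j)) ->
  mmap1 h (m + m')%MM = mmap1 h m * mmap1 h m'.
Proof.
move=> comm_h; rewrite /mmap1 -prodrM_comm => [|i j _ _].
  by apply: eq_bigr => i _; rewrite mnmDE exprD.
exact/commrX/commr_sym/commrX/commr_sym.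
Qed.

(** Pigeonhole: some exponent of [m] is at least [N]. *)
Lemma mmap1_nilpotent (A : nzRingType) (s N : nat) (h : 'I_s -> A) (E : A)
    (m : 'X_{1..s}) :
  (forall i j, GRing.comm (h i) (h j)) -> (forall i, h i ^+ N * E = 0) ->
  (s * N < mdeg m)%N -> mmap1 h m * E = 0.
Proof.
move=> comm_h nil_h lt_m.
have [i lt_i] : exists i, (N <= m i)%N.
  apply/existsP; apply: contraLR lt_m; rewrite negb_exists => /forallP lt_mN.
  rewrite -leqNgt mdegE -[s in (_ <= s * _)%N]card_ord -sum_nat_const.
  by apply: leq_sum => i _; rewrite ltnW // ltnNge lt_mN.
have -> : m = (m - (U_(i) *+ N) + (U_(i) *+ N))%MM.
  apply/mnmP => j; rewrite mnmDE mnmBE mulmnE mnm1E.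
  by have [<-|ij] := eqVneq i j; rewrite ?mul1n ?subnK // mul0n subn0 addn0.
rewrite mmap1_comm_add // -mulrA; suff -> : mmap1 h (U_(i) *+ N)%MM = h i ^+ N.
  by rewrite nil_h mulr0.
elim: N {lt_m lt_i nil_h} => [|N IH]; first by rewrite mulm0n mmap11.
by rewrite mulmS mmap1_comm_add // mmap1U IH exprS.
Qed.

Section MatrixCoefficient.
Variables (K : numFieldType) (s n : nat).
Variables (u : 'rV[K]_n.+1) (h : 'I_s -> 'M[K]_n.+1) (E : 'M[K]_n.+1) (k : nat).
Hypothesis comm_h : forall i j, GRing.comm (h i) (h j).
Hypothesis comm_hE : forall i, GRing.comm (h i) E.
Hypothesis nil_h : forall m : 'X_{1..s}, (k <= mdeg m)%N -> mmap1 h m * E = 0.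

Definition mfact (m : 'X_{1..s}) : K := \prod_i (m i)`!%:R.

(** The symbol q_w: when T_(e_i) = theta_i + h_i, it satisfies
    (q_w(D) x^a)(theta) = u T_a E w, by the binomial expansion of T_a;
    see [matcoef_polyP]. The bound [k] on the degree loses nothing, since the
    products of [k] of the [h i] vanish on the image of [E]. *)
Definition matcoef_poly (w : 'cV[K]_n.+1) : {mpoly K[s]} :=
  \sum_(m : 'X_{1..s < k})
    ((u *m (mmap1 h m * E) *m w) 0 0 / mfact m) *: 'X_[m].

Lemma mfact_neq0 m : mfact m != 0.
Proof. by apply/prodf_neq0 => i _; rewrite pnatr_eq0 -lt0n fact_gt0. Qed.

Lemma matcoef_polyE w m :
  (matcoef_poly w)@_m = (u *m (mmap1 h m * E) *m w) 0 0 / mfact m.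
Proof.
have [lt_mk|le_km] := ltnP (mdeg m) k.
  exact: (mcoeff_mpoly (fun m => (u *m (mmap1 h m * E) *m w) 0 0 / mfact m)).
rewrite nil_h // mulmx0 mul0mx mxE mul0r raddf_sum big1 //= => m' _.
rewrite mcoeffZ mcoeffX; case: eqVneq => [e|]; last by rewrite mulr0.
by move: (bmdeg m'); rewrite e ltnNge le_km.
Qed.

Lemma matcoef_poly_linear c v w :
  matcoef_poly (c *: v + w) = c *: matcoef_poly v + matcoef_poly w.
Proof.
apply/mpolyP => m; rewrite mcoeffD mcoeffZ !matcoef_polyE mulmxDr -scalemxAr.
by rewrite !mxE mulrDl mulrA.
Qed.

Lemma matcoef_poly0 : matcoef_poly 0 = 0.
Proof.
by apply/mpolyP => m; rewrite matcoef_polyE mulmx0 mxE mul0r mcoeff0.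
Qed.

(** Differentiation lowers m!, so it moves the monomial in the [h i] from the
    coefficients to [w]. *)
Lemma matcoef_poly_mderivm w m :
  (matcoef_poly w)^`M[m] = matcoef_poly (mmap1 h m *m w).
Proof.
apply/mpolyP => m'; rewrite mcoeff_mderivm !matcoef_polyE.
have -> : u *m (mmap1 h m' * E) *m (mmap1 h m *m w)
    = u *m (mmap1 h (m + m')%MM * E) *m w.
  rewrite mulmxA -[u *m _ *m mmap1 h m]mulmxA; congr (_ *m _ *m _).
  rewrite addmC mmap1_comm_add // -[RHS]mulrA -[LHS]mulrA; congr (_ * _).
  by apply: commr_prod => i _; exact/commrX/commr_sym.
rewrite -mulr_natr -mulrA; congr (_ * _).
apply: (mulfI (mfact_neq0 (m + m')%MM)).
rewrite mulrA divff ?mfact_neq0 // mul1r.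
apply: (mulIf (mfact_neq0 m')); rewrite mulfVK ?mfact_neq0 //.
rewrite natr_prod -big_split; apply: eq_bigr => i _ /=.
by rewrite -natrM mnmDE -{2}[m' i](addKn (m i)) ffact_fact ?leq_addr.
Qed.

Lemma polyD_matcoef_poly p w :
  polyD p (matcoef_poly w) =
  matcoef_poly (\sum_(m <- msupp p) p@_m *: (mmap1 h m *m w)).
Proof.
rewrite /polyD; elim: (msupp p) => [|m r IH].
  by rewrite !big_nil matcoef_poly0.
by rewrite !big_cons IH matcoef_poly_mderivm matcoef_poly_linear.
Qed.

End MatrixCoefficient.

Lemma Zs_ind (s : nat) (P : Zs s -> Prop) :
  P 0 -> (forall i, P (unitZ i)) -> (forall a b, P a -> P b -> P (a + b)) ->
  (forall a, P a -> P (- a)) -> forall a, P a.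
Proof.
move=> P0 P1 PD PN a.
have PMn x n : P x -> P (x *+ n).
  by move=> Px; elim: n => [|n IH]; rewrite ?mulr0n // mulrS; apply: PD.
have PMz x (z : int) : P x -> P (x *~ z).
  by move=> Px; case: z => n; [|apply: PN]; apply: PMn.
have -> : a = \sum_i unitZ i *~ a i.
  apply/ffunP => j; rewrite sum_ffunE (bigD1 j) //= big1 => [|i ij].
    by rewrite ffunMzE ffunE eqxx addr0 -mulrzr mul1r intz.
  by rewrite ffunMzE ffunE eq_sym (negbTE ij) mul0rz.
by apply: (big_ind P) => // i _; apply/PMz/P1.
Qed.

Section MatrixCoefficientEval.
Variables (K : numFieldType) (s n : nat).
Variables (u : 'rV[K]_n.+1) (T : Zs s -> 'M[K]_n.+1) (E : 'M[K]_n.+1) (k : nat).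
Variable theta : 'I_s -> K.
Hypothesis T0 : T 0 = 1.
Hypothesis TD : forall a b, T (a + b) = T a * T b.
Hypothesis TE : forall a, GRing.comm (T a) E.
Hypothesis theta_neq0 : forall i, theta i != 0.

Let h i := T (unitZ i) - (theta i)%:M.
Hypothesis nil_h : forall m : 'X_{1..s}, (k <= mdeg m)%N -> mmap1 h m * E = 0.

Lemma translation_comm a b : GRing.comm (T a) (T b).
Proof. by rewrite /GRing.comm -!TD addrC. Qed.

Lemma comm_nilpart i j : GRing.comm (h i) (h j).
Proof.
have commS x A : GRing.comm A (x%:M : 'M[K]_n.+1) by apply: scalar_mxC.
apply: commrB; last exact: commS.
apply/commr_sym/commrB; last exact: commS.
exact: translation_comm.
Qed.

Lemma comm_nilpart_proj i : GRing.comm (h i) E.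
Proof. by apply/commr_sym/commrB; [apply/commr_sym/TE | apply: scalar_mxC]. Qed.

(** By [polyD_laurent_shift], translating by e_i replaces q_w by
    theta_i q_w + d_i q_w = q_((theta_i + h_i) w). The translations for which
    the identity holds form a subgroup because the [T z] are invertible. *)
Lemma matcoef_poly_translate a z w :
  polyD_laurent (matcoef_poly u h E k w) (a + z) theta =
  polyD_laurent (matcoef_poly u h E k (T z *m w)) a theta.
Proof.
move: a w; elim/Zs_ind: z => [a w|i a w|z z' IH IH' a w|z IH a w].
- by rewrite T0 addr0 mul1mx.
- rewrite polyD_laurent_shift // -mderivmU1m matcoef_poly_mderivm //.
  + rewrite -matcoef_poly_linear // mmap1U /h mulmxBl mul_scalar_mx.
    by rewrite addrC subrK.
  + exact: comm_nilpart.
  + exact: comm_nilpart_proj.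
- by rewrite addrA IH' IH TD mulmxA.
- have {1}-> : w = T z *m (T (- z) *m w).
    by rewrite mulmxA -[_ *m T _]TD subrr T0 mul1mx.
  by rewrite -IH subrK.
Qed.

Lemma matcoef_polyP a w :
  polyD_laurent (matcoef_poly u h E k w) a theta = (u *m (T a * E) *m w) 0 0.
Proof.
rewrite -[a in LHS]add0r matcoef_poly_translate polyD_laurent_at0.
rewrite matcoef_polyE //.
rewrite mmap11 mul1r /mfact big1 => [|i _]; last by rewrite mnm0E.
by rewrite divr1 TE !mulmxA.
Qed.

End MatrixCoefficientEval.

(** * The block of one frequency *)

(** An idempotent restricts to the identity on its image: its rank
    factorization is a splitting. *)
Lemma row_col_base_idem (K : fieldType) (n : nat) (E : 'M[K]_n) :
  E *m E = E -> row_base E *m col_base E = 1%:M.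
Proof.
move=> idemE.
have CRCR : col_base E *m (row_base E *m col_base E) *m row_base E =
    col_base E *m 1%:M *m row_base E.
  by rewrite mulmx1 mulmxA mulmx_base -mulmxA mulmx_base.
exact: (row_full_inj (col_base_full E)
  (row_free_inj (row_base_free E) CRCR)).
Qed.

Lemma mul_col_base_idem (K : fieldType) (n : nat) (E : 'M[K]_n) :
  E *m E = E -> E *m col_base E = col_base E.
Proof.
move=> idemE; rewrite -[RHS]mulmx1 -(row_col_base_idem idemE) mulmxA.
by congr (_ *m _); rewrite mulmx_base.
Qed.

Section Block.
Variables (K : numFieldType) (s n : nat).
Variables (u : 'rV[K]_n.+1) (T : Zs s -> 'M[K]_n.+1).
Variables (E G : 'M[K]_n.+1) (k : nat).
Variable theta : 'I_s -> K.
Hypothesis T0 : T 0 = 1.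
Hypothesis TD : forall a b, T (a + b) = T a * T b.
Hypothesis TE : forall a, GRing.comm (T a) E.
Hypothesis theta_neq0 : forall i, theta i != 0.
Let h i := T (unitZ i) - (theta i)%:M.
Hypothesis nil_h : forall m : 'X_{1..s}, (k <= mdeg m)%N -> mmap1 h m * E = 0.
Hypothesis separating :
  forall w : 'cV[K]_n.+1, (forall a, u *m T a *m w = 0) -> w = 0.
Hypothesis idemE : E * E = E.
Hypothesis EG : E *m G = G *m E^T.
Hypothesis unitG : G \in unitmx.

Let q := matcoef_poly u h E k.

Definition matcoef_space : {pred {mpoly K[s]}} :=
  fun p => `[< exists w, p = matcoef_poly u h E k w >].

Definition matcoef_basis : (\rank E).-tuple {mpoly K[s]} :=
  [tuple matcoef_poly u h E k (col j (col_base E)) | j < \rank E].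

(** The Gram matrix of the form [G] on the rows of a basis of the row space of
    [E]. *)
Definition matcoef_gram : 'M[K]_(\rank E) := row_base E *m G *m (row_base E)^T.

Lemma matcoef_spaceP p : reflect (exists w, p = q w) (p \in matcoef_space).
Proof. exact: asboolP. Qed.

Lemma matcoef_space_submod : submod_closed matcoef_space.
Proof.
split=> [|c p p' /matcoef_spaceP[w ->] /matcoef_spaceP[w' ->]];
  apply/matcoef_spaceP.
  by exists 0; rewrite /q matcoef_poly0.
by exists (c *: w + w'); rewrite /q matcoef_poly_linear.
Qed.

Lemma matcoef_space_Dinv : D_invariant matcoef_space.
Proof.
move=> p /matcoef_spaceP[w ->] p'; apply/matcoef_spaceP.
rewrite /q polyD_matcoef_poly //; first by eexists.
- exact: comm_nilpart.
- exact: comm_nilpart_proj.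
Qed.

Lemma matcoef_poly_sum p (c : 'I_p -> K) (w : 'I_p -> 'cV[K]_n.+1) :
  \sum_j c j *: q (w j) = q (\sum_j c j *: w j).
Proof.
elim/big_rec2: _ => [|j w' p' _ ->]; first by rewrite /q matcoef_poly0.
by rewrite /q matcoef_poly_linear.
Qed.

(** The kernel of w |-> q_w is that of [E], because q_w determines the values
    u T_a E w, which determine E w; so the columns of [col_base E], a basis of
    the image of [E], give a basis. *)
Lemma matcoef_basisP : is_basis matcoef_basis matcoef_space.
Proof.
have sumE c : \sum_j c j *: tnth matcoef_basis j =
    q (col_base E *m (\col_j c j)).
  rewrite (eq_bigr (fun j => c j *: q (col j (col_base E)))) => [|j _].
    rewrite matcoef_poly_sum; congr q; apply/colP => i.
    by rewrite summxE mxE; apply: eq_bigr => j _; rewrite !mxE mulrC.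
  by rewrite tnth_mktuple.
split=> [c|p].
  rewrite sumE => q0.
  have : col_base E *m (\col_j c j) = 0.
    rewrite -(mul_col_base_idem idemE) -mulmxA; apply: separating => a.
    have -> : u *m T a *m (E *m (col_base E *m \col_j c j)) =
        u *m (T a * E) *m (col_base E *m \col_j c j) by rewrite !mulmxA.
    apply/matrixP => i j; rewrite !ord1 [RHS]mxE.
    rewrite -(matcoef_polyP u T0 TD TE theta_neq0 nil_h) -/q q0.
    by rewrite polyD_laurent0.
  move/(congr1 (mulmx (row_base E))); rewrite mulmxA.
  rewrite (row_col_base_idem idemE) mul1mx mulmx0.
  by move=> /colP c0 j; have := c0 j; rewrite !mxE.
split=> [/matcoef_spaceP[w ->]|[c ->]]; last first.
  by rewrite sumE; apply/matcoef_spaceP; eexists.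
exists (fun j => (row_base E *m w) j 0); rewrite sumE.
have -> : \col_j (row_base E *m w) j 0 = row_base E *m w.
  by apply/colP => j; rewrite mxE.
rewrite mulmxA mulmx_base; apply/mpolyP => m; rewrite /q !matcoef_polyE //.
by rewrite !mulmxA -[_ *m E *m E]mulmxA [E *m E]idemE.
Qed.

Lemma matcoef_gram_unit : matcoef_gram \in unitmx.
Proof.
apply: (proj1 (@mulmx1_unit _ _ _ ((col_base E)^T *m invmx G *m col_base E) _)).
rewrite /matcoef_gram; move: (row_col_base_idem idemE).
move: (mul_col_base_idem idemE) (mulmx_base E).
move: (col_base E) (row_base E) => C R EC CR RC.
rewrite !mulmxA -[_ *m R^T *m C^T]mulmxA -trmx_mul CR.
by rewrite -[_ *m G *m E^T]mulmxA -EG mulmxA mulmxK // -mulmxA EC.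
Qed.

Lemma matcoef_basis_eval a :
  \row_j polyD_laurent (tnth matcoef_basis j) a theta = u *m T a *m col_base E.
Proof.
apply/rowP => j; rewrite mxE tnth_mktuple.
rewrite (matcoef_polyP u T0 TD TE theta_neq0 nil_h).
rewrite -[in RHS](mul_col_base_idem idemE); move: (col_base E) => C.
have -> : u *m (T a * E) *m col j C = col j (u *m T a *m (E *m C)).
  by rewrite !colE !mulmxA.
by rewrite mxE.
Qed.

(** Uses E G E^T = E E G = E G. *)
Lemma matcoef_gram_factor a b :
  (\row_j polyD_laurent (tnth matcoef_basis j) a theta) *m matcoef_gram *m
    (\row_j polyD_laurent (tnth matcoef_basis j) b theta)^T =
  u *m T a *m E *m G *m (u *m T b)^T.
Proof.
rewrite !matcoef_basis_eval /matcoef_gram.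
move: (mulmx_base E); move: (col_base E) (row_base E) => C R CR.
rewrite [in LHS]trmx_mul !mulmxA -[_ *m C *m R]mulmxA CR.
rewrite -[_ *m R^T *m C^T]mulmxA -trmx_mul CR.
rewrite -[_ *m G *m E^T]mulmxA -EG !mulmxA; congr (_ *m _ *m _).
by rewrite -[_ *m E *m E]mulmxA [E *m E]idemE.
Qed.

End Block.

(** * The factorization *)

Lemma mxdiag_mul (K : pzRingType) (m : nat) (n : 'I_m -> nat)
    (F F' : forall i, 'M[K]_(n i)) :
  (\mxdiag_i F i) *m (\mxdiag_i F' i) = \mxdiag_i (F i *m F' i).
Proof.
rewrite [X in _ *m X]/mxdiag mul_mxdiag_mxblock /mxdiag.
apply: eq_mxblock => i j.
by case: eqVneq => [<-|]; rewrite ?conform_mx_id ?mulmx0.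
Qed.

Lemma mxdiag_unitmx (K : fieldType) (m : nat) (n : 'I_m -> nat)
    (F : forall i, 'M[K]_(n i)) :
  (forall i, F i \in unitmx) -> \mxdiag_i F i \in unitmx.
Proof.
move=> unitF; apply: (proj1 (@mulmx1_unit _ _ _ (\mxdiag_i invmx (F i)) _)).
rewrite mxdiag_mul -mxdiagZ; apply: eq_mxdiag => i.
exact: mulmxV.
Qed.

Lemma trmul3_laurent (K : fieldType) (s m : nat) (n : 'I_m -> nat)
    (theta : 'I_m -> 'I_s -> K) (Q : forall i, (n i).-tuple {mpoly K[s]})
    (F : forall i, 'M[K]_(n i)) (A B : set (Zs s)) (x : A) (y : B) :
  let V i (a : Zs s) := \row_j polyD_laurent (tnth (Q i) j) a (theta i) in
  trmul3 (laurent_vandermonde (A := A) theta Q) (\mxdiag_i F i)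
    (laurent_vandermonde (A := B) theta Q) x y =
  \sum_i (V i (\val x) *m F i *m (V i (\val y))^T) 0 0.
Proof.
move=> V.
have rowE (C : set (Zs s)) (c : C) :
    \row_k laurent_vandermonde theta Q k c = \mxrow_i V i (\val c).
  by apply/rowP => k; rewrite !mxE.
rewrite -summxE -mul_mxrow_mxcol -mul_mxrow_mxdiag -tr_mxrow -!rowE.
rewrite /trmul3 mxE exchange_big; apply: eq_bigr => l _.
by rewrite !mxE mulr_suml; apply: eq_bigr => k _; rewrite !mxE.
Qed.

(** The direct implication, with the points e^omega in place of the frequencies.
    The operators are evaluated on Laurent monomials; on N_0^s these are the
    monomials, so the factorization over N_0^s is a restriction. *)
Lemma hermite_factorization (K : numClosedFieldType) (s r : nat)
    (f : Zs s -> K) :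
  (forall n (a b : 'I_n -> Zs s),
     hankel_minor f a b \in unitmx -> (n <= r)%N) ->
  exists (m : nat) (theta : 'I_m -> 'I_s -> K) (n : 'I_m -> nat)
    (SQ : 'I_m -> {pred {mpoly K[s]}})
    (Q : forall i, (n i).-tuple {mpoly K[s]}) (F : forall i, 'M[K]_(n i)),
    let V i a := \row_j polyD_laurent (tnth (Q i) j) a (theta i) in
    [/\ injective theta, forall i j, theta i j != 0,
        forall i, [/\ submod_closed (SQ i), D_invariant (SQ i) &
                      is_basis (Q i) (SQ i)],
        forall i, F i \in unitmx &
        forall x y, f (x + y) = \sum_i (V i x *m F i *m (V i y)^T) 0 0].
Proof.
move=> /symmetric_realization[[|n] [u [a [G [ua unitG fE]]]]].
  (* For n = 0 the function f is zero, and there are no frequencies. *)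
  exists 0%N, (fun _ _ => 1), (fun=> 0%N), (fun=> (xpred0 : {pred _})),
    (fun=> [tuple]), (fun=> 0).
  split; [by case|by case|by case|by case|] => x y.
  by rewrite fE mxE !big_ord0.
pose T := translation u a.
have T0 : T 0 = 1 := translation0 ua unitG fE.
have TD y z : T (y + z) = T y * T z := translationD ua unitG fE y z.
have uT x z : u (x + z) = u x *m T z := translationP ua unitG fE x z.
have TG z : T z *m G = G *m (T z)^T := translation_selfadjoint ua unitG fE z.
have TT := translation_comm TD.
have [I [th [E [N [inj_th sumE idemE nilE closE]]]]] :=
  joint_spectral_idempotents (fun i j => TT (unitZ i) (unitZ j)).
(* Polynomials in the T_z commute with the commutant of the T_z, and they are
   self-adjoint. The two properties are proved together: the adjoint of A B is
   B A, so self-adjointness passes to products only because they commute. *)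
have PE t : (forall A, (forall z, GRing.comm A (T z)) -> GRing.comm A (E t)) /\
    E t *m G = G *m (E t)^T.
  pose P (B : 'M[K]_n.+1) :=
    (forall A, (forall z, GRing.comm A (T z)) -> GRing.comm A B) /\
    B *m G = G *m B^T.
  apply: (closE t P) => [c|A B [cA AG] [cB BG]|A B [cA AG] [cB BG]|i].
  - split=> [A _|]; first exact: scalar_mxC.
    by rewrite tr_scalar_mx scalar_mxC.
  - split=> [C CT|]; first by apply: commrD; [apply: cA|apply: cB].
    by rewrite linearD /= mulmxDl mulmxDr AG BG.
  - split=> [C CT|]; first by apply: commrM; [apply: cA|apply: cB].
    have AB : A * B = B * A.
      by apply/cB => z; apply/commr_sym/cA => z'; apply: TT.
    by rewrite {2}AB trmx_mul mulmxA -AG -[A *m G *m _]mulmxA -BG mulmxA.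
  by split=> [A|]; [apply|apply: TG].
have TE z t : GRing.comm (T z) (E t) by apply: (PE t).1; apply: TT.
have EG t : E t *m G = G *m (E t)^T by apply: (PE t).2.
(* The zero idempotents belong to tuples that are not joint eigenvalues and
   may have zero coordinates; they are discarded. *)
pose J := [set t | E t != 0]%SET.
pose t_ (i : 'I_#|J|) := enum_val i.
have Et_neq0 i : E (t_ i) != 0 by have := enum_valP i; rewrite inE.
have th_neq0 i j : th (t_ i) j != 0.
  apply: contraNneq (Et_neq0 i) => th0; have := nilE (t_ i) j.
  rewrite th0 raddf0 subr0 => TE0.
  have /unitrX : T (unitZ j) \is a GRing.unit.
    apply/unitrP; exists (T (- unitZ j)).
    by rewrite -!TD subrr addNr T0.
  by move=> /(_ N)/mulrI inj; apply/eqP/inj; rewrite TE0 mulr0.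
pose h i j := T (unitZ j) - (th (t_ i) j)%:M.
(* A monomial of degree above s N has an exponent at least N. *)
pose k := (s * N).+1.
have nil_h i (m : 'X_{1..s}) : (k <= mdeg m)%N -> mmap1 (h i) m * E (t_ i) = 0.
  by apply: mmap1_nilpotent => [j l|j]; [apply: comm_nilpart|apply: nilE].
have sep (w : 'cV[K]_n.+1) : (forall z, u 0 *m T z *m w = 0) -> w = 0.
  move=> w0; apply: (rows_separate ua) => x.
  by rewrite mulmx0 -[x]add0r uT w0.
exists #|J|, (fun i => th (t_ i)), (fun i => \rank (E (t_ i))),
  (fun i => matcoef_space (u 0) T (E (t_ i)) k (th (t_ i))),
  (fun i => matcoef_basis (u 0) T (E (t_ i)) k (th (t_ i))),
  (fun i => matcoef_gram (E (t_ i)) G).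
split=> [i i' /inj_th/enum_val_inj //|//|i|i|x y].
- split.
  + exact: matcoef_space_submod (nil_h i).
  + exact: (matcoef_space_Dinv TD (TE^~ (t_ i)) (nil_h i)).
  + exact: (matcoef_basisP T0 TD (TE^~ (t_ i)) (th_neq0 i) (nil_h i) sep
      (idemE (t_ i))).
- exact: matcoef_gram_unit (idemE _) (EG _) unitG.
pose g t := (u 0 *m T x *m E t *m G *m (u 0 *m T y)^T) 0 0.
transitivity (\sum_i g (t_ i)).
  rewrite -(big_enum_val g) big_mkcond /= fE /g -!uT !add0r.
  rewrite -[u x in LHS]mulmx1 -[1%:M]/(1 : 'M_n.+1) -sumE.
  rewrite mulmx_sumr !mulmx_suml summxE.
  apply: eq_bigr => t _; rewrite inE; case: eqVneq => // ->.
  by rewrite mulmx0 !mul0mx mxE.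
apply: eq_bigr => i _; symmetry.
by rewrite (matcoef_gram_factor (u 0) T0 TD (TE^~ (t_ i)) (th_neq0 i) (nil_h i)
  (idemE _) (EG _)).
Qed.

Lemma hankel_finite_rank_factor (R : realType) (s N : nat) (f : Zs s -> R[i])
    (V : 'I_N -> ([set: Zs s])%classic -> R[i]) (F : 'M[R[i]]_N) :
  hankel f setT setT = trmul3 V F V -> hankel_finite_rank f.
Proof.
move=> fV; exists N => A B.
pose pt (z : Zs s) : (setT : set (Zs s)) := SigSub (mem_set (I : setT z)).
pose W (C : {fset Zs s}) :=
  \matrix_(j < #|` C|, k < N) V k (pt (enum_fset C)`_j).
have -> : hankel_mx f A B = W A *m F *m (W B)^T.
  apply/matrixP => i j; rewrite mxE.
  have -> : f ((enum_fset A)`_i + (enum_fset B)`_j) =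
      trmul3 V F V (pt (enum_fset A)`_i) (pt (enum_fset B)`_j) by rewrite -fV.
  rewrite /trmul3 exchange_big mxE; apply: eq_bigr => l _.
  by rewrite !mxE mulr_suml; apply: eq_bigr => k _; rewrite !mxE.
by rewrite -mulmxA (leq_trans (mxrankM_maxl _ _)) ?rank_leq_col.
Qed.

Theorem corollary2p9 (R : realType) (s : nat) (s_ge1 : (1 <= s)%N)
    (f : Zs s -> R[i]) :
  hankel_finite_rank f <->
  exists (m : nat) (Omega : 'I_m -> freq R s) (n : 'I_m -> nat)
    (SQ : 'I_m -> {pred {mpoly R[i][s]}})
    (Q : forall i : 'I_m, (n i).-tuple {mpoly R[i][s]})
    (F : forall i : 'I_m, 'M[R[i]]_(n i)),
    let Theta := fun i : 'I_m => freq_exp (Omega i) in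
    let V := hermite_vandermonde Theta Q in
    let VZ := laurent_vandermonde Theta Q in
    let FD := \mxdiag_(i < m) F i in
    injective Omega /\
    (forall i : 'I_m, submod_closed (SQ i)) /\
    (forall i : 'I_m, D_invariant (SQ i)) /\
    (forall i : 'I_m, is_basis (Q i) (SQ i)) /\
    FD \in unitmx /\
    (forall A B : set (Zs s), A `<=` N0s s -> B `<=` N0s s ->
       hankel f A B = trmul3 (V A) FD (V B)) /\
    hankel f (N0s s) (N0s s) =
      trmul3 (V (N0s s)) FD (V (N0s s)) /\
    (forall A B : set (Zs s),
       hankel f A B = trmul3 (VZ A) FD (VZ B)).
Proof.
split=> [|[m [Omega [n [SQ [Q [F [_ [_ [_ [_ [_ [_ [_ fVZ]]]]]]]]]]]]]];
  last first.
  exact: hankel_finite_rank_factor (fVZ setT setT).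
move=> /hankel_finite_rank_minor[r /hermite_factorization].
case=> m [theta [n [SQ [Q [F [inj_theta theta_neq0 SQP unitF fE]]]]]].
have /(_ _)/cid Omega_ i := freq_exp_surj (theta_neq0 i).
pose Omega i := projT1 (Omega_ i).
have ThetaE : theta = fun i => freq_exp (Omega i).
  by apply: funext => i; rewrite /Omega; case: (Omega_ i).
exists m, Omega, n, SQ, Q, F => Theta V VZ FD.
have fVZ (A B : set (Zs s)) : hankel f A B = trmul3 (VZ A) FD (VZ B).
  apply: funext => x; apply: funext => y.
  by rewrite /VZ trmul3_laurent /hankel fE ThetaE.
have VVZ (A : set (Zs s)) : A `<=` N0s s -> V A = VZ A.
  move=> A_ge0; apply: funext => k; apply: funext => a.
  rewrite /V /VZ /hermite_vandermonde /laurent_vandermonde.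
  by rewrite polyD_laurentE //; apply/A_ge0/set_valP.
have fV (A B : set (Zs s)) : A `<=` N0s s -> B `<=` N0s s ->
    hankel f A B = trmul3 (V A) FD (V B).
  by move=> A_ge0 B_ge0; rewrite !VVZ.
split; first by move=> i j ij; apply: inj_theta; rewrite ThetaE ij.
do 3![split; first by move=> i; case: (SQP i)].
by do !split=> //; [apply: mxdiag_unitmx|apply: fV].
Qed.
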